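(* There is a polynomial-time algorithm which, given a star interdependent network with bidirectional interdependency, represented by a finite undirected bipartite graph $G=(S\cup R,E)$, finds a set $X\subseteq S\cup R$ of minimum cardinality whose removal leads to total failure.
   Context: A star interdependent network with bidirectional interdependency is modelled by a finite undirected bipartite graph $G=(V,E)$, $V=S\cup R$ with $S$ (substations) and $R$ (routers) disjoint; an edge $\{s,r\}$ with $s\in S$, $r\in R$ means that $s$ provides power to $r$ and $r$ provides control to $s$ (equivalently, both directed edges $(s,r)$ and $(r,s)$ are present). In the network before any removals, every node has at least one incident edge. The generator and the control center never fail and are directly connected to all substations and all routers respectively, so they are not part of $G$. Cascade: when a set $X\subseteq V$ is removed (with all incident edges), put $V_0=V\setminus X$ and let $V_{t+1}$ be the set of nodes $v\in V_t$ having a neighbour in $V_t$. The sequence stabilizes; nodes of the final set are operating, and all other nodes have failed. The removal of $X$ leads to total failure if the final set is empty. *)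

(* Defs.v *)
From mathcomp Require Import all_boot.

Set Implicit Arguments.
Unset Strict Implicit.
Unset Printing Implicit Defensive.

(* Star interdependent networks with bidirectional interdependency.  S is the
   set of substations, R the set of routers, and the undirected edge {s, r} is
   the pair (s, r) \in E.  The generator and the control center never fail and
   are not represented. *)

Section Network.

Variables (S R : finType) (E : {set S * R}).

Definition node : finType := (S + R)%type.

Definition adj (u v : node) : bool :=
  match u, v with
  | inl s, inr r => (s, r) \in E
  | inr r, inl s => (s, r) \in E
  | _, _ => false
  end.

Definition no_isolated_node : Prop := forall v : node, exists u : node, adj v u.

(* cascade X t is the set V_t of the nodes left at round t when X is removed. *)
Fixpoint cascade (X : {set node}) (t : nat) : {set node} :=
  if t is t'.+1 then
    [set v in cascade X t' | [exists u in cascade X t', adj v u]]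
  else ~: X.

Definition final_set (X F : {set node}) : Prop :=
  exists t0, forall t, t0 <= t -> cascade X t = F.

Definition total_failure (X : {set node}) : Prop := final_set X set0.

Lemma final_set_exists (X : {set node}) : exists F, final_set X F.
Proof.
have sub t : cascade X t.+1 \subset cascade X t.
  by apply/subsetP => v; rewrite inE => /andP[].
suff main n t : #|cascade X t| < n -> exists F, final_set X F.
  exact: (main #|cascade X 0|.+1 0).
elim: n t => // n IHn t le_tn.
have [eqt|neqt] := eqVneq (cascade X t.+1) (cascade X t).
  exists (cascade X t), t => u /subnKC <-.
  elim: (u - t) => [|k IHk]; first by rewrite addn0.
  by rewrite addnS -[RHS]eqt /= IHk.
apply: (IHn t.+1); rewrite -ltnS; apply: leq_trans le_tn; rewrite ltnS.
by apply: proper_card; rewrite properEneq neqt sub.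
Qed.

Lemma final_set_unique (X F F' : {set node}) :
  final_set X F -> final_set X F' -> F = F'.
Proof.
move=> [t ht] [t' ht']; rewrite -(ht (maxn t t')) ?leq_maxl //.
by rewrite ht' ?leq_maxr.
Qed.

End Network.

(* Random access machines of Cook and Reckhow (Time bounded random access
   machines, 1973), over natural numbers: registers X_0, X_1, ... and sequential
   input and output.  Every instruction takes one time unit; the only arithmetic
   is addition and (truncated) subtraction, so that register contents gain at
   most one bit per step and polynomial time is the same as for Turing
   machines. *)

Inductive instr : Type :=
  | IConst of nat & nat       (* IConst i c  : X_i <- c *)
  | IAdd of nat & nat & nat   (* IAdd i j k  : X_i <- X_j + X_k *)
  | ISub of nat & nat & nat   (* ISub i j k  : X_i <- X_j - X_k *)
  | ILoad of nat & nat        (* ILoad i j   : X_i <- X_(X_j) *)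
  | IStore of nat & nat       (* IStore i j  : X_(X_i) <- X_j *)
  | IJpos of nat & nat        (* IJpos j m   : go to m if X_j > 0 *)
  | IRead of nat              (* IRead i     : X_i <- next input, 0 if none *)
  | IPrint of nat.            (* IPrint i    : output X_i *)

Definition program := seq instr.

Record config : Type := Config {
  pc : nat;
  reg : nat -> nat;
  input : seq nat;
  output : seq nat
}.

Definition upd (f : nat -> nat) (i x : nat) : nat -> nat :=
  fun j => if j == i then x else f j.

Definition exec (a : instr) (c : config) : config :=
  let: Config l X inp out := c in
  match a with
  | IConst i n => Config l.+1 (upd X i n) inp out
  | IAdd i j k => Config l.+1 (upd X i (X j + X k)) inp out
  | ISub i j k => Config l.+1 (upd X i (X j - X k)) inp out
  | ILoad i j => Config l.+1 (upd X i (X (X j))) inp out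
  | IStore i j => Config l.+1 (upd X (X i) (X j)) inp out
  | IJpos j m => Config (if 0 < X j then m else l.+1) X inp out
  | IRead i => Config l.+1 (upd X i (head 0 inp)) (behead inp) out
  | IPrint i => Config l.+1 X inp (rcons out (X i))
  end.

(* The machine halts by leaving its program; halted configurations are fixed. *)
Definition step (P : program) (c : config) : config :=
  if onth P (pc c) is Some a then exec a c else c.

Definition start (w : seq nat) : config := Config 0 (fun=> 0) w [::].

Definition outputs_within (P : program) (w : seq nat) (T : nat) (o : seq nat) :
    Prop :=
  let c := iter T (step P) (start w) in size P <= pc c /\ output c = o.

(* Total number of binary digits of the entries of w. *)
Definition bitlen (w : seq nat) : nat := \sum_(x <- w) (trunc_log 2 x).+1.

(* The nodes of each side are numbered from 0 by enum_rank.  An input lists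
   |S|, |R|, |E| and then the two end points of every edge, with the edges in
   an arbitrary order. *)
Definition encodes (S R : finType) (E : {set S * R}) (w : seq nat) : Prop :=
  exists2 es : seq (S * R), perm_eq es (enum E) &
    w = [:: #|S|; #|R|; #|E|]
        ++ flatten [seq [:: nat_of_ord (enum_rank e.1);
                             nat_of_ord (enum_rank e.2)] | e <- es].

(* The 0-1 characteristic sequence of X, substations first. *)
Definition node_set_code (S R : finType) (X : {set node S R}) : seq nat :=
  [seq nat_of_bool (inl s \in X) | s <- enum S]
    ++ [seq nat_of_bool (inr r \in X) | r <- enum R].

(* Main.v *)
Require Import Defs.
From mathcomp Require Import all_boot zify.

Set Implicit Arguments.
Unset Strict Implicit.
Unset Printing Implicit Defensive.

(** A node v outside X survives the first round exactly when some edge at v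
    avoids X, and the two ends of such an edge keep each other alive for ever.
    Hence X leads to total failure if and only if X is a vertex cover of the
    bipartite graph ([total_failure_cover]), and the task is to compute a
    minimum vertex cover in polynomial time.

    The algorithm is a unit-increment auction, which needs no augmenting path.
    Every router r carries a price, initially 0.  A substation s without a
    router bids for a cheapest neighbour r: it takes r over, evicting the
    previous owner, and the price of r goes up by 1.  A substation all of whose
    neighbours cost at least |R| + 2 retires.  Each bid raises the sum of the
    prices, which stays at most |R| (|R| + 2), so there are polynomially many
    bids.  Three facts survive a bid ([market_bid]): a router with a positive
    price is owned; a router costs at most 1 more than any other
    neighbour of its owner, who chose a cheapest one, and prices never fall; and a
    substation that has been processed is an owner, or is the current bidder,
    or has only expensive neighbours.

    There are |R| prices and |R| + 1 levels 1, ..., |R| + 1, so some level g is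
    not a price ([gap_exists]).  Take the routers priced above g together with
    the substations that have a neighbour priced below g.  This is a cover,
    since no price equals g.  Each of its nodes lies on an owner-router pair,
    and no pair contains two of them: the substation of a pair whose router
    costs more than g has no neighbour priced below g.  The pairs are disjoint
    edges, so every cover has at least one node per pair, and the cover chosen
    is minimum ([price_cover_min]).

    For the machine, the algorithm is written in a small language of while
    programs over named arrays, which [compile] turns into random access
    machine code.  The judgement [runs N c st Q] says that the compiled c leads
    from st to a state satisfying Q within [cost N c] machine steps; its rule for
    loops asks for a variant bounded by N.  For a fixed program [cost N c] is
    polynomial in N ([cost_poly]), so bounding the running time reduces to
    bounding each loop by N = (|E| + 2)^2.  As no node is isolated, |S| and |R|
    are at most |E|, which is at most the length of the input. *)

(** * Total failure and vertex covers *)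

(** One round without survivors if X is a cover; an edge that avoids X keeps both
    its ends alive in all rounds. *)
Lemma total_failure_cover (S R : finType) (E : {set S * R}) (X : {set node S R}) :
  total_failure E X <->
  forall s r, (s, r) \in E -> (inl s \in X) || (inr r \in X).
Proof.
split=> [[t0 final] s r sr|cov].
  apply/negPn/negP; rewrite negb_or => /andP[sX rX].
  suff alive t : (inl s \in cascade E X t) /\ (inr r \in cascade E X t).
    by have [+ _] := alive t0; rewrite final // inE.
  elim: t => [|t [IHs IHr]]; first by rewrite !inE.
  by rewrite !inE IHs IHr; split; apply/existsP; [exists (inr r) | exists (inl s)];
    rewrite ?IHr ?IHs.
exists 1 => -[//|t] _; elim: t => [|t IHt].
  apply/setP => v; rewrite !inE; apply/negP => /andP[vX /existsP[u]].
  rewrite inE => /andP[uX]; case: v u vX uX => [s|r] [s'|r'] //= vX uX /cov.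
    by rewrite (negPf vX) (negPf uX).
  by rewrite (negPf vX) (negPf uX).
by apply/setP => v; rewrite [cascade _ _ _.+2]/= -/(cascade E X t.+1) inE IHt !inE.
Qed.

(** The abstract situation after the auction: [owner] is a matching of routers to
    substations, and the price g is taken by no router. *)
Section Cover.

Variables (S R : finType) (E : {set S * R}).
Variables (price : R -> nat) (owner : R -> option S) (g : nat).

Definition price_cover : {set node S R} :=
  [set v : node S R | match v with
    | inl s => [exists r, ((s, r) \in E) && (price r < g)]
    | inr r => g < price r
    end].

Hypothesis price_neq : forall r, price r <> g.
Hypothesis high_sold : forall r, g < price r -> owner r.
Hypothesis owner_edge : forall r s, owner r = Some s -> (s, r) \in E.
Hypothesis owner_content : forall r s r', owner r = Some s -> (s, r') \in E ->
  price r <= (price r').+1.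
Hypothesis owner_inj : forall r r' s, owner r = Some s -> owner r' = Some s -> r = r'.
Hypothesis low_served : forall s r, (s, r) \in E -> price r < g ->
  exists r', owner r' = Some s.

Lemma price_cover_total_failure : total_failure E price_cover.
Proof.
apply/total_failure_cover => s r sr; rewrite !inE.
case: (ltngtP (price r) g) => [ltg|_|/price_neq//]; rewrite ?orbT // orbF.
by apply/existsP; exists r; rewrite sr.
Qed.

(** The cover injects into the owned routers, one node per owner-router pair,
    and the owned routers inject into any cover Y, which contains an end of each
    of these disjoint edges. *)
Lemma price_cover_min (Y : {set node S R}) :
  total_failure E Y -> #|price_cover| <= #|Y|.
Proof.
move=> /total_failure_cover covY.
pose seller r : node S R := if owner r is Some s then inl s else inr r.
pose M := [set r | isSome (owner r)].
apply: (@leq_trans #|M|).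
  (* The end of the pair of r that may lie in the cover. *)
  pose h r := if g < price r then inr r else seller r.
  apply: leq_trans (leq_imset_card h M); apply/subset_leq_card/subsetP.
  case=> [s|r]; rewrite inE => high; apply/imsetP.
    have [r /andP[sr ltg]] := existsP high; have [r' own'] := low_served sr ltg.
    exists r'; first by rewrite inE own'.
    by rewrite /h /seller own' ltnNge (leq_trans (owner_content own' sr)).
  by exists r; rewrite ?inE ?high_sold // /h high.
(* An end of the pair of r that lies in Y. *)
pose h r := if inr r \in Y then inr r else seller r.
have h_inj : {in M &, injective h}.
  move=> r r'; rewrite !inE /h /seller.
  case own: (owner r) => [s|] // _; case own': (owner r') => [s'|] // _.
  case: ifP => _; case: ifP => _ // [] //.
  by move=> eqs; apply: owner_inj own _; rewrite own' eqs.
rewrite -(card_in_imset h_inj); apply/subset_leq_card/subsetP => v /imsetP[r rM ->{v}].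
move: rM; rewrite inE /h /seller; case own: (owner r) => [s|] // _.
by case: ifP => // rY; have := covY _ _ (owner_edge own); rewrite rY orbF.
Qed.

End Cover.

(** * A language of while programs and its compilation *)

(** Scalars and arrays of the program alike: a scalar is an array of which only
    entry 0 is in use. *)
Inductive name : Type :=
  | NS | NR | NE | Src | Dst | Price | Owner
  | Todo | Cur | Edge | Low | Best | Evicted | Level | Node | Flag | Gap.

Definition tag (a : name) : nat :=
  match a with
  | NS => 1 | NR => 2 | NE => 3 | Src => 4 | Dst => 5 | Price => 6 | Owner => 7
  | Todo => 8 | Cur => 9 | Edge => 10 | Low => 11 | Best => 12 | Evicted => 13
  | Level => 14 | Node => 15 | Flag => 16 | Gap => 17
  end.

Definition memory := name -> nat -> nat.

(** The other arrays are left unchanged as functions, not just pointwise, so that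
    framing equations rewrite under arbitrary predicates. *)
Definition put (m : memory) (a : name) (i x : nat) : memory :=
  fun b => if tag b == tag a then upd (m b) i x else m b.

Inductive expr : Type :=
  | Const of nat
  | Get of name & expr
  | Add of expr & expr
  | Sub of expr & expr.

Fixpoint eval (m : memory) (e : expr) : nat :=
  match e with
  | Const n => n
  | Get a e => m a (eval m e)
  | Add e1 e2 => eval m e1 + eval m e2
  | Sub e1 e2 => eval m e1 - eval m e2
  end.

Inductive cmd : Type :=
  | Skip
  | Put of name & expr & expr
  | Read of name & expr
  | Print of expr
  | Seq of cmd & cmd
  | If of expr & cmd & cmd
  | While of expr & cmd.

(** The machine memory is divided into 32 interleaved tracks: track 0 holds the
    temporaries of expression evaluation, and track [tag a] the array a. *)
Definition temp (d : nat) : nat := 32 * d.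
Definition addr (a : name) (i : nat) : nat := 32 * i + tag a.

(** Turns the index in temporary d into an address of array a; five doublings
    multiply by 32.  The term is locked because simplification of a
    concatenation would otherwise unfold it. *)
Definition scale (d : nat) (a : name) : seq instr :=
  locked (nseq 5 (IAdd (temp d) (temp d) (temp d))
    ++ [:: IConst (temp d.+1) (tag a); IAdd (temp d) (temp d) (temp d.+1)]).

(** Leaves the value in temporary d, using only temporaries from d on. *)
Fixpoint code_expr (d : nat) (e : expr) : seq instr :=
  match e with
  | Const n => [:: IConst (temp d) n]
  | Get a e => code_expr d e ++ scale d a ++ [:: ILoad (temp d) (temp d)]
  | Add e1 e2 =>
      code_expr d e1 ++ code_expr d.+1 e2
        ++ [:: IAdd (temp d) (temp d) (temp d.+1)]
  | Sub e1 e2 =>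
      code_expr d e1 ++ code_expr d.+1 e2
        ++ [:: ISub (temp d) (temp d) (temp d.+1)]
  end.

(** The code is meant to be placed at address [off]; jumps are absolute. *)
Fixpoint compile (c : cmd) (off : nat) : seq instr :=
  match c with
  | Skip => [::]
  | Put a e1 e2 =>
      code_expr 0 e1 ++ scale 0 a ++ code_expr 1 e2
        ++ [:: IStore (temp 0) (temp 1)]
  | Read a e =>
      code_expr 0 e ++ scale 0 a
        ++ [:: IRead (temp 1); IStore (temp 0) (temp 1)]
  | Print e => code_expr 0 e ++ [:: IPrint (temp 0)]
  | Seq c1 c2 =>
      let p1 := compile c1 off in p1 ++ compile c2 (off + size p1)
  | If e c1 c2 =>
      let q := code_expr 0 e in
      let p2 := compile c2 (off + size q + 1) in
      let mid := off + size q + 1 + size p2 + 2 in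
      let p1 := compile c1 mid in
      q ++ [:: IJpos (temp 0) mid] ++ p2
        ++ [:: IConst (temp 0) 1; IJpos (temp 0) (mid + size p1)] ++ p1
  | While e c =>
      let q := code_expr 0 e in
      let body := off + size q + 3 in
      let p := compile c body in
      q ++ [:: IJpos (temp 0) body; IConst (temp 0) 1;
               IJpos (temp 0) (body + size p + 2)]
        ++ p ++ [:: IConst (temp 0) 1; IJpos (temp 0) off]
  end.

(** A bound on the number of machine steps if each activation of a loop makes at
    most N rounds. *)
Fixpoint cost (N : nat) (c : cmd) : nat :=
  match c with
  | Seq c1 c2 => cost N c1 + cost N c2
  | If e c1 c2 => size (code_expr 0 e) + cost N c1 + cost N c2 + 3
  | While e c =>
      N * (size (code_expr 0 e) + cost N c + 3) + (size (code_expr 0 e) + 3)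
  | _ => size (compile c 0)
  end.

(** The tags of the arrays that c may change; 0 stands for the output tape. *)
Fixpoint writes (c : cmd) : seq nat :=
  match c with
  | Skip => [::]
  | Put a _ _ | Read a _ => [:: tag a]
  | Print _ => [:: 0]
  | Seq c1 c2 | If _ c1 c2 => writes c1 ++ writes c2
  | While _ c => writes c
  end.

(** A nesting level of loops costs one factor N. *)
Lemma cost_poly c : exists a k, forall N, cost N c <= a * N.+1 ^ k.
Proof.
have base n : exists a k, forall N, n <= a * N.+1 ^ k.
  by exists n, 0 => N; rewrite muln1.
have add (f g : nat -> nat) : (exists a k, forall N, f N <= a * N.+1 ^ k) ->
    (exists a k, forall N, g N <= a * N.+1 ^ k) ->
    exists a k, forall N, f N + g N <= a * N.+1 ^ k.
  move=> [a [k fN]] [b [l gN]]; exists (a + b), (k + l) => N.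
  rewrite mulnDl; apply: leq_add.
    by apply: leq_trans (fN N) _; rewrite leq_mul2l leq_pexp2l ?leq_addr ?orbT.
  by apply: leq_trans (gN N) _; rewrite leq_mul2l leq_pexp2l ?leq_addl ?orbT.
elim: c => [|a e1 e2|a e|e|c1 IH1 c2 IH2|e c1 IH1 c2 IH2|e c IHc] /=.
- exact: base.
- exact: base.
- exact: base.
- exact: base.
- exact: add.
- exact: (add _ _ (add _ _ (add _ _ (base _) IH1) IH2) (base _)).
have [a [k le_ak]] := add _ _ (add _ _ (base (size (code_expr 0 e))) IHc) (base 3).
apply: (add _ _ _ (base _)).
exists a, k.+1 => N; rewrite expnS mulnCA; exact: leq_mul (leqnSn N) (le_ak N).
Qed.

Definition straight (a : instr) : bool := if a is IJpos _ _ then false else true.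

Definition code_at (P : program) (off : nat) (p : seq instr) : Prop :=
  forall i, i < size p -> onth P (off + i) = onth p i.

Lemma code_at_cat P off p1 p2 : code_at P off (p1 ++ p2) ->
  code_at P off p1 /\ code_at P (off + size p1) p2.
Proof.
move=> Pp; split=> i lti.
  by rewrite Pp ?size_cat ?ltn_addr // onth_cat lti.
rewrite -addnA Pp ?size_cat ?ltn_add2l // onth_cat ltnNge leq_addr /=.
by rewrite addKn.
Qed.

Definition exec_all (p : seq instr) (c : config) : config :=
  foldl (fun c a => exec a c) c p.

Lemma exec_all_cat p1 p2 c : exec_all (p1 ++ p2) c = exec_all p2 (exec_all p1 c).
Proof. exact: foldl_cat. Qed.

Lemma pc_exec a c : straight a -> pc (exec a c) = (pc c).+1.
Proof. by case: a c => [? ?|? ? ?|? ? ?|? ?|? ?|? ?|?|?] []. Qed.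

Lemma iter_straight P p c : all straight p -> code_at P (pc c) p ->
  iter (size p) (step P) c = exec_all p c.
Proof.
elim: p c => [//|a p IHp] c /andP[sa sp] Pp; rewrite [size _]/= iterSr.
have := Pp 0 isT; rewrite addn0 /= {2}/step => ->; apply: IHp => //.
by move=> i lti; rewrite pc_exec // addSnnS Pp.
Qed.

Lemma tag_bounds a : 0 < tag a < 32. Proof. by case: a. Qed.

Lemma temp_neq_addr d a i : (temp d == addr a i) = false.
Proof. rewrite /temp /addr; have := tag_bounds a; lia. Qed.

Lemma addr_neq_temp d a i : (addr a i == temp d) = false.
Proof. by rewrite eq_sym temp_neq_addr. Qed.

Lemma eq_temp d d' : (temp d == temp d') = (d == d').
Proof. rewrite /temp; lia. Qed.

Lemma eq_addr a b i j : (addr a i == addr b j) = (tag a == tag b) && (i == j).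
Proof. rewrite /addr; have := tag_bounds a; have := tag_bounds b; lia. Qed.

(** The temporaries are unconstrained, so every jump and evaluation may clobber
    them. *)
Definition represents (X : nat -> nat) (m : memory) : Prop :=
  forall a i, X (addr a i) = m a i.

Lemma represents_temp X m d x : represents X m -> represents (upd X (temp d) x) m.
Proof. by move=> Xm a i; rewrite /upd addr_neq_temp. Qed.

Lemma represents_put X m a i x :
  represents X m -> represents (upd X (addr a i) x) (put m a i x).
Proof.
move=> Xm b j; rewrite /upd eq_addr /put.
by case: eqP => [eq_ba|_] /=; rewrite /upd Xm.
Qed.

(** Preservation of the lower temporaries is what lets the first operand survive
    the evaluation of the second. *)
Definition computes (p : seq instr) (d : nat) (m : memory) (X : nat -> nat)
    (x : nat) : Prop :=
  forall off inp out, exists X',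
  [/\ exec_all p (Config off X inp out) = Config (off + size p) X' inp out,
      represents X' m, X' (temp d) = x &
      forall d', d' < d -> X' (temp d') = X (temp d')].

Lemma doublingP n t off X inp out : exists X',
  [/\ exec_all (nseq n (IAdd t t t)) (Config off X inp out) =
        Config (off + n) X' inp out,
      X' t = 2 ^ n * X t & forall u, u != t -> X' u = X u].
Proof.
elim: n off X => [|n IHn] off X.
  by exists X; split; rewrite ?addn0 ?mul1n.
have [X' [run X't X'u]] := IHn off.+1 (upd X t (X t + X t)).
exists X'; split; first by rewrite /= run addSnnS.
  by rewrite X't /upd eqxx addnn expnSr -mulnA mul2n.
by move=> u neq_ut; rewrite X'u // /upd (negPf neq_ut).
Qed.

Lemma scaleP d a m X : represents X m ->
  computes (scale d a) d m X (addr a (X (temp d))).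
Proof.
move=> Xm off inp out; rewrite /scale -lock.
have [X' [run X'd X'u]] := doublingP 5 (temp d) off X inp out.
have neq_d : (temp d == temp d.+1) = false by rewrite eq_temp ltn_eqF.
exists (upd (upd X' (temp d.+1) (tag a)) (temp d) (addr a (X (temp d)))); split.
- rewrite exec_all_cat run /=.
  by rewrite !addnS addn0 /upd neq_d eqxx X'd.
- do 2!apply: represents_temp; move=> b j.
  by rewrite X'u ?Xm // addr_neq_temp.
- by rewrite /upd eqxx.
- move=> d' ltd; rewrite /upd !eq_temp !ltn_eqF ?X'u ?eq_temp ?ltn_eqF //.
  exact: ltnW.
Qed.

Lemma code_exprP e d m X : represents X m ->
  computes (code_expr d e) d m X (eval m e).
Proof.
elim: e d X => [n|a e IHe|e1 IH1 e2 IH2|e1 IH1 e2 IH2] d X Xm off inp out /=.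
- exists (upd X (temp d) n); split; rewrite /upd ?eqxx ?addn1 //.
    exact: represents_temp.
  by move=> d' ltd; rewrite eq_temp ltn_eqF.
- have [X1 [run1 X1m X1d X1lt]] := IHe d X Xm off inp out.
  have [X2 [run2 X2m X2d X2lt]] :=
    scaleP d a X1m (off + size (code_expr d e)) inp out.
  exists (upd X2 (temp d) (X2 (X2 (temp d)))); split.
  + rewrite !exec_all_cat run1 run2 /=.
    by rewrite !size_cat addn1 !addnS !addnA.
  + exact: represents_temp.
  + by rewrite /upd eqxx X2d X2m X1d.
  + by move=> d' ltd; rewrite /upd eq_temp ltn_eqF // X2lt ?X1lt.
- have [X1 [run1 X1m X1d X1lt]] := IH1 d X Xm off inp out.
  have [X2 [run2 X2m X2d X2lt]] :=
    IH2 d.+1 X1 X1m (off + size (code_expr d e1)) inp out.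
  exists (upd X2 (temp d) (X2 (temp d) + X2 (temp d.+1))); split.
  + rewrite !exec_all_cat run1 run2 /=.
    by rewrite !size_cat addn1 !addnS !addnA.
  + exact: represents_temp.
  + by rewrite /upd eqxx X2d X2lt ?X1d.
  + by move=> d' ltd; rewrite /upd eq_temp ltn_eqF // X2lt ?X1lt // ltnW.
- have [X1 [run1 X1m X1d X1lt]] := IH1 d X Xm off inp out.
  have [X2 [run2 X2m X2d X2lt]] :=
    IH2 d.+1 X1 X1m (off + size (code_expr d e1)) inp out.
  exists (upd X2 (temp d) (X2 (temp d) - X2 (temp d.+1))); split.
  + rewrite !exec_all_cat run1 run2 /=.
    by rewrite !size_cat addn1 !addnS !addnA.
  + exact: represents_temp.
  + by rewrite /upd eqxx X2d X2lt ?X1d.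
  + by move=> d' ltd; rewrite /upd eq_temp ltn_eqF // X2lt ?X1lt // ltnW.
Qed.

Lemma straight_scale d a : all straight (scale d a).
Proof. by rewrite /scale -lock. Qed.

Lemma straight_code_expr d e : all straight (code_expr d e).
Proof.
by elim: e d => [n|a e IHe|e1 IH1 e2 IH2|e1 IH1 e2 IH2] d; rewrite /= ?all_cat ?IHe ?IH1 ?IH2 ?straight_scale.
Qed.

Record state : Type := State { mem : memory; inp : seq nat; out : seq nat }.

Definition reaches (P : program) (T : nat) (c c' : config) : Prop :=
  exists2 t, t <= T & iter t (step P) c = c'.

Lemma reaches_trans P T1 T2 c1 c2 c3 :
  reaches P T1 c1 c2 -> reaches P T2 c2 c3 -> reaches P (T1 + T2) c1 c3.
Proof.
move=> [t1 le1 <-] [t2 le2 <-]; exists (t2 + t1); last by rewrite iterD.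
by rewrite addnC leq_add.
Qed.

Lemma reaches_leq P T T' c c' : T <= T' -> reaches P T c c' -> reaches P T' c c'.
Proof. by move=> leT [t let_ <-]; exists t => //; apply: leq_trans leT. Qed.

Lemma reaches_straight P p c : all straight p -> code_at P (pc c) p ->
  reaches P (size p) c (exec_all p c).
Proof. by move=> sp Pp; exists (size p) => //; rewrite iter_straight. Qed.

Definition frame (c : cmd) (st st' : state) : Prop :=
  (forall a, tag a \notin writes c -> mem st' a = mem st a) /\
  (0 \notin writes c -> out st' = out st).

(** Total correctness of compiled code with a time bound.  The frame is part of
    the judgement, so loop invariants need not mention what the body does not
    write. *)
Definition runs (N : nat) (c : cmd) (st : state) (Q : state -> Prop) : Prop :=
  forall P off X, code_at P off (compile c off) -> represents X (mem st) ->
  exists X' st',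
  [/\ reaches P (cost N c) (Config off X (inp st) (out st))
        (Config (off + size (compile c off)) X' (inp st') (out st')),
      represents X' (mem st'), frame c st st' & Q st'].

Lemma frame_refl c st : frame c st st. Proof. by []. Qed.

Lemma frame_trans c st1 st2 st3 :
  frame c st1 st2 -> frame c st2 st3 -> frame c st1 st3.
Proof.
move=> [f12 o12] [f23 o23]; split=> [a wa|w0]; first by rewrite f23 ?f12.
by rewrite o23 ?o12.
Qed.

Lemma frame_sub c c' st st' :
  {subset writes c <= writes c'} -> frame c st st' -> frame c' st st'.
Proof.
move=> sub [f o]; split=> [a wa|w0].
  by apply: f; apply: contra wa; apply: sub.
by apply: o; apply: contra w0; apply: sub.
Qed.

Section Rules.

Variable N : nat.
Implicit Types (Q : state -> Prop) (st : state).

Lemma runs_post c st Q Q' : runs N c st Q ->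
  (forall st', frame c st st' -> Q st' -> Q' st') -> runs N c st Q'.
Proof.
move=> cQ QQ' P off X Pc Xm; have [X' [st' [r Xm' f q]]] := cQ P off X Pc Xm.
by exists X', st'; split=> //; apply: QQ'.
Qed.

Lemma runs_skip st Q : Q st -> runs N Skip st Q.
Proof.
by move=> q P off X _ Xm; exists X, st; rewrite /= addn0; split=> //; exists 0.
Qed.

(** Common part of the rules for commands compiled without jumps. *)
Lemma runs_straight c st st' Q : all straight (compile c 0) ->
    (forall off, compile c off = compile c 0) ->
    cost N c = size (compile c 0) ->
    (forall off X, represents X (mem st) -> exists2 X',
      exec_all (compile c 0) (Config off X (inp st) (out st)) =
      Config (off + size (compile c 0)) X' (inp st') (out st')
      & represents X' (mem st')) ->
  frame c st st' -> Q st' -> runs N c st Q.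
Proof.
move=> sc eqc costc run f q P off X Pc Xm.
have [X' run' Xm'] := run off X Xm; exists X', st'; split=> //.
rewrite costc eqc -run'; apply: reaches_straight => //=.
by rewrite -(eqc off).
Qed.

Lemma runs_put a e1 e2 m i o Q :
    Q (State (put m a (eval m e1) (eval m e2)) i o) ->
  runs N (Put a e1 e2) (State m i o) Q.
Proof.
apply: runs_straight => //=.
- by rewrite !all_cat /= !straight_code_expr ?straight_scale.
- move=> off X Xm.
  have [X1 [run1 X1m X1d _]] := code_exprP e1 0 Xm off i o.
  have [X2 [run2 X2m X2d _]] :=
    scaleP 0 a X1m (off + size (code_expr 0 e1)) i o.
  have [X3 [run3 X3m X3d X3lt]] :=
    code_exprP e2 1 X2m (off + size (code_expr 0 e1) + size (scale 0 a)) i o.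
  exists (upd X3 (addr a (eval m e1)) (eval m e2)).
    rewrite !exec_all_cat run1 run2.
    rewrite run3 /=.
    by rewrite !size_cat X3d X3lt // X2d X1d !addnA addn1.
  exact: represents_put.
- by split=> //= b; rewrite inE /put => /negPf ->.
Qed.

Lemma runs_read a e m i o Q :
    Q (State (put m a (eval m e) (head 0 i)) (behead i) o) ->
  runs N (Read a e) (State m i o) Q.
Proof.
apply: runs_straight => //=.
- by rewrite !all_cat /= !straight_code_expr ?straight_scale.
- move=> off X Xm.
  have [X1 [run1 X1m X1d _]] := code_exprP e 0 Xm off i o.
  have [X2 [run2 X2m X2d _]] :=
    scaleP 0 a X1m (off + size (code_expr 0 e)) i o.
  pose X3 := upd X2 (temp 1) (head 0 i).
  have X31 : X3 (temp 1) = head 0 i by rewrite /X3 /upd eqxx.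
  have X30 : X3 (temp 0) = addr a (eval m e) by rewrite /X3 /upd eq_temp X2d X1d.
  exists (upd X3 (addr a (eval m e)) (head 0 i)).
    rewrite !exec_all_cat run1 run2 /= -/X3 X30 X31.
    by rewrite !size_cat !addnA addn2.
  by apply: represents_put; apply: represents_temp.
- by split=> //= b; rewrite inE /put => /negPf ->.
Qed.

Lemma runs_print e m i o Q :
    Q (State m i (rcons o (eval m e))) -> runs N (Print e) (State m i o) Q.
Proof.
apply: runs_straight => //=; first by rewrite !all_cat /= !straight_code_expr ?straight_scale.
move=> off X Xm; have [X1 [run1 X1m X1d _]] := code_exprP e 0 Xm off i o.
exists X1 => //; rewrite !exec_all_cat run1 /=.
by rewrite !size_cat !addnA addn1 X1d.
Qed.

Lemma runs_seq c1 c2 st Q :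
  runs N c1 st (fun st' => frame c1 st st' -> runs N c2 st' Q) ->
  runs N (Seq c1 c2) st Q.
Proof.
move=> run1 P off X /= /code_at_cat[P1 P2] Xm.
have [X1 [st1 [r1 X1m f1 run2]]] := run1 P off X P1 Xm.
have [X2 [st2 [r2 X2m f2 q]]] := run2 f1 P _ X1 P2 X1m.
exists X2, st2; split=> //; first by rewrite size_cat addnA; apply: reaches_trans r2.
by apply: frame_trans (frame_sub _ f1) (frame_sub _ f2) => x /= xw;
  rewrite mem_cat xw ?orbT.
Qed.

Lemma step_reaches P c a : onth P (pc c) = Some a -> reaches P 1 c (exec a c).
Proof. by move=> Pa; exists 1; rewrite //= /step Pa. Qed.

Lemma test_reaches P e off l X st : code_at P off (code_expr 0 e) ->
    code_at P (off + size (code_expr 0 e)) [:: IJpos (temp 0) l] ->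
    represents X (mem st) -> exists2 X', represents X' (mem st) &
  reaches P (size (code_expr 0 e) + 1) (Config off X (inp st) (out st))
    (Config (if 0 < eval (mem st) e then l else (off + size (code_expr 0 e)).+1)
      X' (inp st) (out st)).
Proof.
move=> Pe Pj Xm.
have [X' [run X'm <- _]] := code_exprP e 0 Xm off (inp st) (out st).
have := reaches_straight (c := Config off X (inp st) (out st))
  (straight_code_expr 0 e) Pe.
rewrite run => r0; exists X' => //; apply: reaches_trans r0 _.
have := Pj 0 isT; rewrite addn0 => {}Pj.
exact: (step_reaches (c := Config _ X' (inp st) (out st)) Pj).
Qed.

(** The machine has only conditional jumps, so the condition is made true. *)
Lemma jump_reaches P off X i o l :
    code_at P off [:: IConst (temp 0) 1; IJpos (temp 0) l] ->
  reaches P 2 (Config off X i o) (Config l (upd X (temp 0) 1) i o).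
Proof.
move=> Pj; rewrite -[2]/(1 + 1).
have := Pj 1 isT; have := Pj 0 isT; rewrite addn0 addn1 => P0 P1.
apply: reaches_trans; first exact: (step_reaches (c := Config off X i o) P0).
exact: (step_reaches (c := Config off.+1 (upd X (temp 0) 1) i o) P1).
Qed.

Lemma runs_if e c1 c2 st Q :
    (0 < eval (mem st) e -> runs N c1 st Q) ->
    (eval (mem st) e = 0 -> runs N c2 st Q) ->
  runs N (If e c1 c2) st Q.
Proof.
move=> run1 run2 P off X; rewrite [compile _ _]/=.
set q := code_expr 0 e; set p2 := compile c2 _; set mid := (_ + 2).
set p1 := compile c1 _ => Pp Xm.
have [Pq {}Pp] := code_at_cat Pp.
have [Pt {}Pp] := code_at_cat (p1 := [:: IJpos (temp 0) mid]) Pp.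
have [P2 {}Pp] := code_at_cat Pp.
have [Pj P1] := code_at_cat
  (p1 := [:: IConst (temp 0) 1; IJpos (temp 0) (mid + size p1)]) Pp.
have [X0 X0m r0] := test_reaches Pq Pt Xm.
have endE : off + size (q ++ [:: IJpos (temp 0) mid] ++ p2 ++
    [:: IConst (temp 0) 1; IJpos (temp 0) (mid + size p1)] ++ p1) = mid + size p1.
  by rewrite !size_cat !addnA.
rewrite endE; case: ltnP r0 => [e_gt0|e_le0] r0.
- have [X' [st' [r1 X'm f q1]]] := run1 e_gt0 P _ X0 P1 X0m.
  exists X', st'; split=> //; last first.
    by apply: frame_sub f => x /= xw; rewrite mem_cat xw.
  by apply: reaches_leq (reaches_trans r0 r1); rewrite /= -/q; lia.
have e0 : eval (mem st) e = 0 by lia.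
have [X' [st' [r1 X'm f q1]]] := run2 e0 P _ X0 P2 X0m.
have rj := jump_reaches X' (inp st') (out st') Pj.
exists (upd X' (temp 0) 1), st'; split=> //; first 1 last.
- exact: represents_temp.
- by apply: frame_sub f => x /= xw; rewrite mem_cat xw orbT.
rewrite -[(off + size q).+1]addn1 in r0.
apply: reaches_leq (reaches_trans r0 (reaches_trans r1 rj)).
by rewrite /= -/q; lia.
Qed.

(** The variant v bounds the number of rounds, hence the initial bound by N. *)
Lemma runs_while (I : state -> Prop) (v : state -> nat) e c st Q :
    I st -> v st <= N ->
    (forall st', frame c st st' -> I st' -> 0 < eval (mem st') e ->
       runs N c st' (fun st'' => I st'' /\ v st'' < v st')) ->
    (forall st', frame c st st' -> I st' -> eval (mem st') e = 0 -> Q st') ->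
  runs N (While e c) st Q.
Proof.
move=> Ist vst body exit P off X; rewrite [compile _ _]/=.
set q := code_expr 0 e; set bd := off + size q + 3; set p := compile c bd.
move=> Pp Xm.
have [Pq {}Pp] := code_at_cat Pp.
have [Pt {}Pp] := code_at_cat
  (p1 := [:: IJpos (temp 0) bd; IConst (temp 0) 1;
             IJpos (temp 0) (bd + size p + 2)]) Pp.
have [Pc Pj] := code_at_cat Pp.
have endE : off + size (q ++ [:: IJpos (temp 0) bd; IConst (temp 0) 1;
     IJpos (temp 0) (bd + size p + 2)] ++ p ++
     [:: IConst (temp 0) 1; IJpos (temp 0) off]) = bd + size p + 2.
  by rewrite !size_cat !addnA.
rewrite endE {endE} [cost _ _]/= -/q.
suff main n st1 X1 : frame c st st1 -> I st1 -> v st1 <= n ->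
    represents X1 (mem st1) -> exists X' st',
    [/\ reaches P (n * (size q + cost N c + 3) + (size q + 3))
          (Config off X1 (inp st1) (out st1))
          (Config (bd + size p + 2) X' (inp st') (out st')),
        represents X' (mem st'), frame c st st' & Q st'].
  have [X' [st' [r X'm f q']]] := main _ st X (frame_refl c st) Ist (leqnn _) Xm.
  exists X', st'; split=> //; apply: reaches_leq r.
  by rewrite leq_add2r leq_mul2r vst orbT.
have Pt0 : code_at P (off + size q) [:: IJpos (temp 0) bd].
  by case=> // _; apply: (Pt 0 isT).
have Pt1 : code_at P (off + size q).+1
    [:: IConst (temp 0) 1; IJpos (temp 0) (bd + size p + 2)].
  by move=> k ltk; have := Pt k.+1 ltk; rewrite addSnnS.
elim: n st1 X1 => [|n IHn] st1 X1 f1 I1 v1 X1m;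
  have [X0 X0m] := test_reaches Pq Pt0 X1m; case: ltnP => [e_gt0|e_le0] r0.
- have [X' [st' [_ _ _ [_]]]] := body st1 f1 I1 e_gt0 P _ X0 Pc X0m.
  by rewrite ltnNge (leq_trans v1).
- have e0 : eval (mem st1) e = 0 by lia.
  exists (upd X0 (temp 0) 1), st1; split=> //; last exact: exit.
    apply: reaches_leq (reaches_trans r0 (jump_reaches _ _ _ Pt1)).
    by rewrite -addnA leq_addl.
  exact: represents_temp.
- have [X2 [st2 [r2 X2m f2 [I2 v2]]]] := body st1 f1 I1 e_gt0 P _ X0 Pc X0m.
  have rj := jump_reaches X2 (inp st2) (out st2) Pj.
  have [X' [st' [r3 X'm f3 q3]]] := IHn st2 (upd X2 (temp 0) 1)
    (frame_trans f1 f2) I2 (leq_trans v2 v1) (represents_temp _ _ X2m).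
  exists X', st'; split=> //.
  apply: reaches_leq (reaches_trans r0 (reaches_trans r2 (reaches_trans rj r3))).
  by rewrite mulSn -/q; lia.
- have e0 : eval (mem st1) e = 0 by lia.
  exists (upd X0 (temp 0) 1), st1; split=> //; last exact: exit.
    apply: reaches_leq (reaches_trans r0 (jump_reaches _ _ _ Pt1)).
    by rewrite -addnA leq_addl.
  exact: represents_temp.
Qed.

End Rules.

Lemma upd_same f i x : upd f i x i = x.
Proof. by rewrite /upd eqxx. Qed.

(** Counts down, so that x is the number of rounds still to come: while the body
    runs, x ranges over e - 1, ..., 0. *)
Definition For (x : name) (e : expr) (c : cmd) : cmd :=
  Seq (Put x (Const 0) e)
    (While (Get x (Const 0))
      (Seq (Put x (Const 0) (Sub (Get x (Const 0)) (Const 1))) c)).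

(** [I k] is the invariant with k rounds to come. *)
Lemma runs_for N (I : nat -> state -> Prop) x e c m i o Q :
    tag x \notin writes c -> eval m e <= N ->
    I (eval m e) (State (put m x 0 (eval m e)) i o) ->
    (forall k m1 i1 o1, k < eval m e ->
       frame (For x e c) (State m i o) (State m1 i1 o1) ->
       I k.+1 (State m1 i1 o1) ->
       runs N c (State (put m1 x 0 k) i1 o1) (I k)) ->
    (forall st, frame (For x e c) (State m i o) st -> I 0 st -> Q st) ->
  runs N (For x e c) (State m i o) Q.
Proof.
move=> xc leN I0 body exit; set n := eval m e in leN I0 body *.
apply: runs_seq; apply: runs_put => /= f0.
have f0' : frame (For x e c) (State m i o) (State (put m x 0 n) i o).
  by apply: frame_sub f0 => y; rewrite /= !inE => ->.
have fw st1 st2 : frame (Seq (Put x (Const 0) (Sub (Get x (Const 0)) (Const 1))) c)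
    st1 st2 -> frame (For x e c) st1 st2.
  by apply: frame_sub => y yw; rewrite [writes _]/= inE yw orbT.
apply: (@runs_while N (fun st => mem st x 0 <= n /\ I (mem st x 0) st)
  (fun st => mem st x 0)) => /=.
- by rewrite /put /upd !eqxx.
- by rewrite /put /upd !eqxx.
- move=> [m1 i1 o1] f1 /= [le1 I1] pos1.
  apply: runs_seq; apply: runs_put => /= f2.
  have km : (m1 x 0 - 1).+1 = m1 x 0 by lia.
  set k := m1 x 0 - 1 in km *; rewrite -km in I1.
  have ltk : k < n by lia.
  have f01 : frame (For x e c) (State m i o) (State m1 i1 o1).
    by exact: frame_trans f0' (fw _ _ f1).
  apply: runs_post (body k m1 i1 o1 ltk f01 I1) _ => st' [f3 _] I3.
  have -> : mem st' x 0 = k by rewrite f3 //= /put /upd !eqxx.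
  by rewrite -km; split=> //; split=> //; apply: ltnW.
- move=> st' f1 [_ I1] x0; apply: exit; last by rewrite -x0.
  by exact: frame_trans f0' (fw _ _ f1).
Qed.

(** With truncated subtraction the sum of both differences is 0 only at equality,
    and the value is 1 or 0. *)
Definition IsEq (e1 e2 : expr) : expr :=
  Sub (Const 1) (Add (Sub e1 e2) (Sub e2 e1)).

Lemma runs_if_eq N e1 e2 c1 c2 st Q :
    (eval (mem st) e1 = eval (mem st) e2 -> runs N c1 st Q) ->
    (eval (mem st) e1 <> eval (mem st) e2 -> runs N c2 st Q) ->
  runs N (If (IsEq e1 e2) c1 c2) st Q.
Proof.
move=> run1 run2; apply: runs_if => /= e12; [apply: run1 | apply: run2]; lia.
Qed.

Lemma runs_if_lt N e1 e2 c1 c2 st Q :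
    (eval (mem st) e1 < eval (mem st) e2 -> runs N c1 st Q) ->
    (eval (mem st) e2 <= eval (mem st) e1 -> runs N c2 st Q) ->
  runs N (If (Sub e2 e1) c1 c2) st Q.
Proof.
move=> run1 run2; apply: runs_if => /= e12; [apply: run1 | apply: run2]; lia.
Qed.

(** * The program *)

Declare Scope prog_scope.
Delimit Scope prog_scope with P.
Notation "! x" := (Get x (Const 0)) (at level 8, format "! x") : prog_scope.
Notation "a .@ e" := (Get a e) (at level 9, e at level 8) : prog_scope.
Notation "x ::= e" := (Put x (Const 0) e) (at level 60) : prog_scope.
Notation "e1 + e2" := (Add e1 e2) : prog_scope.
Notation "e1 - e2" := (Sub e1 e2) : prog_scope.
Notation "c1 ;; c2" := (Seq c1 c2) (at level 80, right associativity) : prog_scope.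

(** Edges fill the arrays from the last index down to 0. *)
Definition load : cmd :=
  (Read NS (Const 0) ;; Read NR (Const 0) ;; Read NE (Const 0) ;;
   For Edge !NE (Read Src !Edge ;; Read Dst !Edge))%P.

(** [Low] starts at the retirement threshold, and keeps this value if no
    neighbour of the bidder is cheaper. *)
Definition search : cmd :=
  (For Edge !NE
    (If (IsEq (Src.@ !Edge + Const 1) !Cur)
      (If (!Low - Price.@ (Dst.@ !Edge))
        (Low ::= Price.@ (Dst.@ !Edge) ;; Best ::= Dst.@ !Edge) Skip)
      Skip))%P.

(** In [Owner] and [Cur] the substation s is coded by s + 1, and 0 stands for
    none. *)
Definition bid : cmd :=
  (Low ::= !NR + Const 2 ;;
   search ;;
   If ((!NR + Const 2) - !Low)
     (Put Price !Best (!Low + Const 1) ;;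
      Evicted ::= Owner.@ !Best ;;
      Put Owner !Best !Cur ;;
      Cur ::= !Evicted)
     (Cur ::= Const 0))%P.

Definition auction : cmd :=
  (For Todo !NS (Cur ::= !Todo + Const 1 ;; While !Cur bid))%P.

Definition find_gap : cmd :=
  (For Level (!NR + Const 1)
    (Flag ::= Const 1 ;;
     For Node !NR
       (If (IsEq (Price.@ !Node) (!Level + Const 1)) (Flag ::= Const 0) Skip) ;;
     If !Flag (Gap ::= !Level + Const 1) Skip))%P.

(** The counter runs downwards, so the node treated is the mirror image of the
    counter; likewise in [print_R]. *)
Definition print_S : cmd :=
  (For Todo !NS
    (Flag ::= Const 0 ;;
     For Edge !NE
       (If (IsEq (Src.@ !Edge) (!NS - (!Todo + Const 1)))
         (If (!Gap - Price.@ (Dst.@ !Edge)) (Flag ::= Const 1) Skip)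
         Skip) ;;
     Print !Flag))%P.

Definition print_R : cmd :=
  (For Node !NR
    (If (Price.@ (!NR - (!Node + Const 1)) - !Gap)
       (Print (Const 1)) (Print (Const 0))))%P.

Definition algorithm : cmd :=
  (load ;; auction ;; find_gap ;; print_S ;; print_R)%P.

(** * The auction *)

Section Algorithm.

Variables (nS nR : nat) (l : seq (nat * nat)).
Hypothesis edge_lt : forall s r : nat, (s, r) \in l -> s < nS /\ r < nR.

(** The substations from [todo] on have entered the auction, and [cur - 1] is the
    current bidder, if [cur] is positive.  [content] is the approximate
    complementary slackness of auctions, with slack 1; [served] says that only
    the current bidder and those priced out of the market hold no router. *)
Record market (price owner : nat -> nat) (todo cur : nat) : Prop := Market {
  price_le : forall r, r < nR -> price r <= nR + 2;
  unsold : forall r, r < nR -> owner r = 0 -> price r = 0;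
  content : forall r s, r < nR -> owner r = s.+1 ->
    (s, r) \in l /\ forall r', (s, r') \in l -> price r <= (price r').+1;
  owner_inj : forall r r', r < nR -> r' < nR -> 0 < owner r ->
    owner r = owner r' -> r = r';
  fresh : forall r, r < nR -> 0 < owner r -> todo < owner r /\ owner r != cur;
  served : forall s, todo <= s < nS -> s.+1 != cur ->
    (exists2 r, r < nR & owner r = s.+1) \/
    (forall r, (s, r) \in l -> nR + 2 <= price r);
  pending : 0 < cur -> todo < cur
}.

Lemma market_init : market (fun=> 0) (fun=> 0) nS 0.
Proof. by split=> // s /andP[/leq_ltn_trans lt /lt]; rewrite ltnn. Qed.

Lemma market_next p o todo : market p o todo.+1 0 -> market p o todo todo.+1.
Proof.
case=> ple uns cont inj fr ser pend; split=> // [r ltr or|s /andP[les lts] neqs].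
  by have [] := fr r ltr or; lia.
by apply: ser; lia.
Qed.

Lemma market_retire p o todo s : market p o todo s.+1 ->
  (forall r, (s, r) \in l -> nR + 2 <= p r) -> market p o todo 0.
Proof.
case=> ple uns cont inj fr ser pend high; split=> // [r ltr or|s' s'_lt _].
  by have [] := fr r ltr or; lia.
by have [-> | neqs] := eqVneq s' s; [right | apply: ser].
Qed.

(** The new owner of r is content because r was a cheapest neighbour; the other
    owners stay content because prices only rise. *)
Lemma market_bid p o todo s r : market p o todo s.+1 ->
    (s, r) \in l -> p r < nR + 2 ->
    (forall r', (s, r') \in l -> p r <= p r') ->
  market (upd p r (p r).+1) (upd o r s.+1) todo (o r).
Proof.
move=> mk sr pr minr; case: (mk) => ple uns cont inj fr ser pend.
have [lts ltr] := edge_lt sr.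
have up r' : p r' <= upd p r (p r).+1 r' by rewrite /upd; case: eqP => [->|].
split.
- by move=> r1 lt1; rewrite /upd; case: eqP => // _; apply: ple.
- by move=> r1 lt1; rewrite /upd; case: eqP => // _; apply: uns.
- move=> r1 s1 lt1; rewrite {1 2}/upd; case: eqP => [->|_].
    by case=> <-; split=> // r' sr'; rewrite ltnS (leq_trans (minr _ sr')).
  move=> /(cont _ _ lt1)[e1 c1]; split=> // r' sr'.
  by apply: leq_trans (c1 _ sr') _; rewrite ltnS.
- move=> r1 r2 lt1 lt2; rewrite /upd; case: eqP => [->|_]; case: eqP => [->|_] //.
  + by move=> _ o2; have [] := fr r2 lt2; rewrite -?o2 ?eqxx.
  + by move=> o1 o1s; have [] := fr r1 lt1 o1; rewrite o1s eqxx.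
  + exact: inj.
- move=> r1 lt1; rewrite /upd; have [_|neq1] := eqVneq r1 r => o1.
    split; [exact: pend | rewrite eq_sym]; case: (posnP (o r)) => [->//|or].
    by have [] := fr r ltr or.
  split; first by have [] := fr r1 lt1 o1.
  by apply: contra_neq neq1; apply: inj.
- move=> s1 lt1 neq1; have [-> | neqs] := eqVneq s1 s.
    by left; exists r; rewrite // /upd eqxx.
  have [[r1 ltr1 o1] | high] := ser s1 lt1 neqs.
    left; exists r1; rewrite // /upd; case: eqP => // eq1.
    by rewrite -o1 eq1 eqxx in neq1.
  by right=> r' sr'; apply: leq_trans (high _ sr') (up r').
- by move=> or; have [] := fr r ltr or.
Qed.

(** The sum of the prices is bounded and each bid raises it, so the auction
    stops. *)
Definition slack (p : nat -> nat) : nat := nR * (nR + 2) - \sum_(r < nR) p r.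

Lemma slack_bid p r : r < nR -> (forall r', r' < nR -> p r' <= nR + 2) ->
  p r < nR + 2 -> slack (upd p r (p r).+1) < slack p.
Proof.
move=> ltr ple pr; rewrite /slack; set q := upd p r (p r).+1.
have sumq : \sum_(i < nR) q i = (\sum_(i < nR) p i).+1.
  rewrite (bigD1 (Ordinal ltr)) //= [in RHS](bigD1 (Ordinal ltr)) //= -addSn.
  congr (_ + _); first by rewrite /q /upd eqxx.
  apply: eq_bigr => i neqi; rewrite /q /upd; case: eqP => // eqi.
  by case/eqP: neqi; apply: val_inj.
have : \sum_(i < nR) q i <= nR * (nR + 2).
  rewrite -[X in X * _]card_ord -sum_nat_const; apply: leq_sum => i _.
  by rewrite /q /upd; case: eqP => // _; apply: ple.
by rewrite sumq; lia.
Qed.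

(** * Correctness of the program *)

Record loaded (m : memory) : Prop := Loaded {
  loadedS : m NS 0 = nS;
  loadedR : m NR 0 = nR;
  loadedE : m NE 0 = size l;
  loaded_edge : forall j, j < size l -> (m Src j, m Dst j) = nth (0, 0) l j
}.

Lemma loaded_agree m m' : loaded m -> (forall a, tag a <= 5 -> m' a = m a) ->
  loaded m'.
Proof. by case=> hS hR hE he eqm; split=> [|||j ltj]; rewrite !eqm ?he. Qed.

Lemma loaded_put m a i x : 5 < tag a -> loaded m -> loaded (put m a i x).
Proof.
move=> lt5 lm; apply: (loaded_agree lm) => b leb; rewrite /put.
by case: eqP => // eqb; move: lt5; rewrite -eqb ltnNge leb.
Qed.

Lemma loaded_frame c st st' : all (fun t => (t == 0) || (5 < t)) (writes c) ->
  frame c st st' -> loaded (mem st) -> loaded (mem st').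
Proof.
move=> wc [f _] lm; apply: (loaded_agree lm) => a le5; apply: f.
apply/negP => /(allP wc); rewrite [5 < _]ltnNge le5 orbF.
by have := tag_bounds a; case: (tag a).
Qed.

Variable N : nat.
Hypotheses (leS : nS <= N) (leR : nR < N) (leE : size l <= N).
Hypothesis le_slack : nR * (nR + 2) < N.

Lemma search_spec s T m i o : loaded m -> m Cur 0 = s.+1 -> m Low 0 = T ->
  runs N search (State m i o) (fun st =>
    (forall r, (s, r) \in l -> mem st Low 0 <= mem st Price r) /\
    (mem st Low 0 < T -> (s, mem st Best 0) \in l /\
       mem st Price (mem st Best 0) = mem st Low 0)).
Proof.
move=> lm cur0 low0.
(* With k rounds to come, the edges seen are those of index at least k. *)
pose I k st := (forall r, (s, r) \in drop k l -> mem st Low 0 <= mem st Price r) /\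
    (mem st Low 0 < T -> (s, mem st Best 0) \in l /\
       mem st Price (mem st Best 0) = mem st Low 0).
apply: (@runs_for N I) => //=.
- by rewrite (loadedE lm).
- by rewrite /I (loadedE lm) drop_size; split=> //=; rewrite /put /= low0 ltnn.
- rewrite (loadedE lm) => k m1 i1 o1 ltk f1 [/= minl best].
  have lm1 : loaded m1 by apply: loaded_frame f1 lm.
  have cur1 : m1 Cur 0 = s.+1 by case: f1 => /(_ Cur isT) /= ->.
  have [src dst] : m1 Src k = (nth (0, 0) l k).1 /\ m1 Dst k = (nth (0, 0) l k).2.
    by rewrite -(loaded_edge lm1 ltk).
  have kl := mem_nth (0, 0) ltk.
  have dropk r : (s, r) \in drop k l = ((s, r) == nth (0, 0) l k) || ((s, r) \in drop k.+1 l).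
    by rewrite (drop_nth (0, 0)) // inE.
  case: (nth _ _ _) src dst kl dropk => a b /= src dst kl dropk.
  apply: runs_if_eq => /=.
    rewrite /put /= cur1 src addn1 => -[eqa].
    apply: runs_if_lt => /=; rewrite /put /= dst => cmp.
      apply: runs_seq; apply: runs_put => /= _; apply: runs_put => /=.
      rewrite /I /put /upd /= dst; split.
        move=> r; rewrite dropk => /orP[/eqP[_ ->]//|/minl].
        by apply: leq_trans; apply: ltnW.
      by rewrite -eqa.
    apply: runs_skip; rewrite /I /put /=; split=> // r.
    by rewrite dropk => /orP[/eqP[_ ->]//|/minl].
  rewrite /put /= cur1 src addn1 => neqa.
  apply: runs_skip; rewrite /I /put /=; split=> // r.
  by rewrite dropk => /orP[/eqP[eqs]|/minl//]; case: neqa; rewrite eqs.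
- by move=> st f [/= minl best]; rewrite drop0 in minl.
Qed.

Lemma bid_spec todo s m i o : loaded m -> m Cur 0 = s.+1 ->
    market (m Price) (m Owner) todo s.+1 ->
  runs N bid (State m i o) (fun st =>
    market (mem st Price) (mem st Owner) todo (mem st Cur 0) /\
    slack (mem st Price) + (0 < mem st Cur 0) < slack (m Price) + 1).
Proof.
move=> lm cur0 mk.
apply: runs_seq; apply: runs_put => /= _.
apply: runs_seq; apply: runs_post.
  apply: (@search_spec s (nR + 2)); first exact: loaded_put.
    by rewrite /put.
  by rewrite /put /upd /= (loadedR lm).
move=> [m1 i1 o1] f1 /= [minl best] _.
have fm a : tag a \notin writes search -> tag a != tag Low -> m1 a = m a.
  by move=> na nl; case: f1 => /(_ a na) /= -> _; rewrite /put (negPf nl).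
rewrite (fm Price) // in minl best.
apply: runs_if_lt => /=; rewrite (fm NR) // (loadedR lm) => cmp.
  have [sb pb] := best cmp; have [_ ltb] := edge_lt sb.
  apply: runs_seq; apply: runs_put => /= _.
  apply: runs_seq; apply: runs_put => /= _.
  apply: runs_seq; apply: runs_put => /= _.
  apply: runs_put => /=; rewrite /put /=.
  rewrite (fm Price) // (fm Owner) // (fm Cur) // cur0 -pb addn1.
  rewrite !upd_same.
  split; first by apply: market_bid => //; rewrite ?pb //.
  have := slack_bid ltb (price_le mk); rewrite pb => /(_ cmp).
  by rewrite -pb; case: (0 < m Owner _); lia.
apply: runs_put; rewrite /put /= (fm Price) // (fm Owner) //; split.
  by apply: market_retire mk _ => r /minl; apply: leq_trans.
by rewrite /upd /=; lia.
Qed.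

Lemma auction_spec m i o : loaded m ->
    m Price = (fun=> 0) -> m Owner = (fun=> 0) ->
  runs N auction (State m i o) (fun st => market (mem st Price) (mem st Owner) 0 0).
Proof.
move=> lm p0 o0.
apply: (@runs_for N (fun k st => market (mem st Price) (mem st Owner) k 0)) => //=.
- by rewrite (loadedS lm).
- by rewrite /put /= p0 o0 (loadedS lm); apply: market_init.
move=> k m1 i1 o1 ltk f1 mk1.
have lm1 : loaded m1 by apply: loaded_frame f1 lm.
apply: runs_seq; apply: runs_put => /= _.
set m2 := put _ _ _ _; have lm2 : loaded m2 by do 2 apply: loaded_put => //.
apply: (@runs_while N
  (fun st => market (mem st Price) (mem st Owner) k (mem st Cur 0))
  (fun st => slack (mem st Price) + (0 < mem st Cur 0))) => /=.
- by rewrite /m2 /put /upd /= addn1; apply: market_next.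
- have : slack (m2 Price) <= nR * (nR + 2) by apply: leq_subr.
  by case: (0 < m2 Cur 0); lia.
- move=> [m3 i3 o3] f3 mk3 /= cur3.
  have lm3 : loaded m3 by apply: loaded_frame f3 lm2.
  have cur3s : m3 Cur 0 = (m3 Cur 0).-1.+1 by rewrite prednK.
  rewrite /= cur3s in mk3.
  apply: runs_post (bid_spec lm3 cur3s mk3) _.
  by move=> st _; rewrite cur3.
- by move=> st f mkst cur_0; rewrite cur_0 in mkst.
Qed.

(** Pigeonhole: |R| prices cannot occupy |R| + 1 levels. *)
Lemma gap_exists (p : nat -> nat) :
  ~ forall v, 0 < v <= nR + 1 -> exists2 r, r < nR & p r = v.
Proof.
move=> onto; have sub : {subset iota 1 nR.+1 <= map p (iota 0 nR)}.
  move=> v; rewrite mem_iota => ltv.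
  have [|r ltr <-] := onto v; first by lia.
  by apply: map_f; rewrite mem_iota.
have := uniq_leq_size (iota_uniq _ _) sub.
by rewrite size_map !size_iota ltnn.
Qed.

Definition gap (p : nat -> nat) (g : nat) : Prop :=
  0 < g <= nR + 1 /\ forall r, r < nR -> p r <> g.

Lemma find_gap_spec m i o : loaded m -> m Gap 0 = 0 ->
  runs N find_gap (State m i o) (fun st => gap (m Price) (mem st Gap 0)).
Proof.
move=> lm gap0.
pose I k st := mem st Gap 0 = 0 /\
    (forall v, k < v <= nR + 1 -> exists2 r, r < nR & m Price r = v) \/
  gap (m Price) (mem st Gap 0).
apply: (@runs_for N I) => //=.
- by rewrite (loadedR lm) addn1.
- by left; split; rewrite /put /= ?gap0 // (loadedR lm) => v /andP[/leq_trans H /H]; rewrite ltnn.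
- rewrite (loadedR lm) => k m1 i1 o1 ltk f1 I1.
  have lm1 : loaded m1 by apply: loaded_frame f1 lm.
  have price1 : m1 Price = m Price by case: f1 => /(_ Price isT) /= ->.
  apply: runs_seq; apply: runs_put => /= _.
  set m2 := put _ _ _ _; have lm2 : loaded m2 by do 2 apply: loaded_put => //.
  pose J j st :=
    mem st Flag 0 = 1 /\ (forall r, j <= r < nR -> m Price r <> k.+1) \/
    mem st Flag 0 = 0 /\ (exists2 r, r < nR & m Price r = k.+1).
  apply: runs_seq; apply: (@runs_for N J) => //=.
  + by rewrite (loadedR lm2) ltnW.
  + by left; split=> // r; rewrite (loadedR lm2) => /andP[/leq_ltn_trans H /H]; rewrite ltnn.
  + rewrite (loadedR lm2) => j m3 i3 o3 ltj f3 J3.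
    have price3 : m3 Price = m Price.
      by case: f3 => /(_ Price isT) /= -> _; rewrite -price1.
    have level3 : m3 Level 0 = k by case: f3 => /(_ Level isT) /= -> _.
    apply: runs_if_eq; rewrite /= /put /= price3 level3 upd_same addn1 => cmp.
      by apply: runs_put; right; split; [rewrite /put /= upd_same | exists j].
    apply: runs_skip; case: J3 => -[/= fl J3]; [left | by right].
    split=> // r /andP[]; rewrite leq_eqVlt => /orP[/eqP <- //|ltr ltR].
    by apply: J3; rewrite ltr.
  + move=> [m3 i3 o3] f3 /= J0 _.
    have level3 : m3 Level 0 = k by case: f3 => /(_ Level isT) /= -> _.
    have gap3 : m3 Gap 0 = m1 Gap 0 by case: f3 => /(_ Gap isT) /= -> _.
    case: J0 => -[/= flag J0]; apply: runs_if; rewrite /= flag // => _.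
      apply: runs_put; right; rewrite /gap /put /= upd_same level3 addn1.
      by split; [lia | move=> r ltr; apply: J0].
    apply: runs_skip; rewrite /I /= gap3; case: I1 => [[g0 onto]|]; [left | by right].
    split=> // v ltv; have [->//|neqv] := eqVneq v k.+1.
    by apply: onto; lia.
- by move=> st f [[_ /gap_exists]|].
Qed.

Definition cheap_edge (p : nat -> nat) (g s : nat) (e : nat * nat) : bool :=
  (e.1 == s) && (p e.2 < g).

Lemma print_S_spec m i o : loaded m ->
  runs N print_S (State m i o) (fun st => out st =
    o ++ [seq nat_of_bool (has (cheap_edge (m Price) (m Gap 0) s) l) | s <- iota 0 nS]).
Proof.
move=> lm; set g := m Gap 0; set p := m Price.
pose I k st := out st =
  o ++ [seq nat_of_bool (has (cheap_edge p g s) l) | s <- iota 0 (nS - k)].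
apply: (@runs_for N I) => //=.
- by rewrite (loadedS lm).
- by rewrite /I (loadedS lm) subnn /= cats0.
- rewrite (loadedS lm) => k m1 i1 o1 ltk f1 I1.
  have lm1 : loaded m1 by apply: loaded_frame f1 lm.
  have price1 : m1 Price = p by case: f1 => /(_ Price isT) /= ->.
  have gap1 : m1 Gap 0 = g by case: f1 => /(_ Gap isT) /= ->.
  apply: runs_seq; apply: runs_put => /= _.
  set m2 := put _ _ _ _; have lm2 : loaded m2 by do 2 apply: loaded_put => //.
  pose s := nS - k.+1.
  pose J j st := mem st Flag 0 = has (cheap_edge p g s) (drop j l).
  apply: runs_seq; apply: (@runs_for N J) => //=.
  + by rewrite (loadedE lm2).
  + by rewrite /J (loadedE lm2) drop_size.
  + rewrite (loadedE lm2) => j m3 i3 o3 ltj f3 J3.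
    have lm3 : loaded m3 by apply: loaded_frame f3 lm2.
    have price3 : m3 Price = p by case: f3 => /(_ Price isT) /= -> _.
    have gap3 : m3 Gap 0 = g by case: f3 => /(_ Gap isT) /= -> _.
    have todo3 : m3 Todo 0 = k by case: f3 => /(_ Todo isT) /= -> _.
    have [src dst] : m3 Src j = (nth (0, 0) l j).1 /\ m3 Dst j = (nth (0, 0) l j).2.
      by rewrite -(loaded_edge lm3 ltj).
    have Jj : has (cheap_edge p g s) (drop j l) =
        cheap_edge p g s (m3 Src j, m3 Dst j) || has (cheap_edge p g s) (drop j.+1 l).
      by rewrite (drop_nth (0, 0)) //= src dst -surjective_pairing.
    rewrite /J Jj /cheap_edge /=.
    apply: runs_if_eq; rewrite /= /put /= upd_same (loadedS lm3) todo3 addn1 -/s => cmp.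
      apply: runs_if_lt; rewrite /= /put /= upd_same gap3 price3 => cmp'.
        by apply: runs_put; rewrite /put /= upd_same cmp eqxx cmp'.
      by apply: runs_skip; rewrite /= ltnNge cmp' andbF.
    by apply: runs_skip; move/eqP/negPf: cmp => ->.
  + move=> [m3 i3 o3] [_ /(_ isT) /= o31]; rewrite /J /= drop0 => flag _.
    apply: runs_print; rewrite /I /= flag o31 [o1]I1 rcons_cat -map_rcons.
    have -> : nS - k = s + 1 by rewrite /s; lia.
    by rewrite iotaD cats1.
- by move=> st f; rewrite /I subn0.
Qed.

Lemma print_R_spec m i o : loaded m ->
  runs N print_R (State m i o) (fun st => out st =
    o ++ [seq nat_of_bool (m Gap 0 < m Price r) | r <- iota 0 nR]).
Proof.
move=> lm; set g := m Gap 0; set p := m Price.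
pose I k st := out st = o ++ [seq nat_of_bool (g < p r) | r <- iota 0 (nR - k)].
apply: (@runs_for N I) => //=.
- by rewrite (loadedR lm) ltnW.
- by rewrite /I (loadedR lm) subnn /= cats0.
- rewrite (loadedR lm) => k m1 i1 o1 ltk f1 I1.
  have lm1 : loaded m1 by apply: loaded_frame f1 lm.
  have price1 : m1 Price = p by case: f1 => /(_ Price isT) /= ->.
  have gap1 : m1 Gap 0 = g by case: f1 => /(_ Gap isT) /= ->.
  have Ik b : b = (g < p (nR - k.+1)) -> rcons o1 (nat_of_bool b) =
      o ++ [seq nat_of_bool (g < p r) | r <- iota 0 (nR - k)].
    move=> ->; rewrite [o1]I1 rcons_cat -map_rcons.
    have -> : nR - k = (nR - k.+1) + 1 by lia.
    by rewrite iotaD cats1.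
  apply: runs_if_lt; rewrite /= /put /= upd_same (loadedR lm1) gap1 price1 addn1 => cmp.
    by apply: runs_print; apply: (Ik true).
  by apply: runs_print; apply: (Ik false); rewrite ltnNge cmp.
- by move=> st f; rewrite /I subn0.
Qed.

Definition pairs (s : seq (nat * nat)) : seq nat :=
  flatten [seq [:: e.1; e.2] | e <- s].

Lemma load_spec m i o : i = [:: nS; nR; size l] ++ pairs (rev l) ->
  runs N load (State m i o) (fun st => loaded (mem st)).
Proof.
move=> ->; do 3 (apply: runs_seq; apply: runs_read => /= _).
pose I k st := [/\ inp st = pairs (rev (take k l)),
  mem st NS 0 = nS, mem st NR 0 = nR, mem st NE 0 = size l &
  forall j, k <= j < size l -> (mem st Src j, mem st Dst j) = nth (0, 0) l j].
apply: (@runs_for N I) => //=.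
- split=> //=; first by rewrite take_size.
  by move=> j /andP[/leq_ltn_trans H /H]; rewrite /put /= upd_same ltnn.
- move=> k m1 i1 o1; rewrite {1}/put /= upd_same => ltk _ [/= i1E hS hR hE he].
  rewrite (take_nth (0, 0)) // rev_rcons in i1E.
  apply: runs_seq; apply: runs_read => /= _; apply: runs_read => /=.
  rewrite /put /= !upd_same i1E /=; split=> //= j /andP[lej ltj].
  rewrite /upd; have [->|neqj] := eqVneq j k; first by rewrite -surjective_pairing.
  by apply: he; lia.
- by move=> st f [_ hS hR hE he]; split.
Qed.

Lemma algorithm_spec :
  runs N algorithm
    (State (fun _ _ => 0) ([:: nS; nR; size l] ++ pairs (rev l)) [::])
    (fun st => exists p o g, [/\ market p o 0 0, gap p g &
      out st = [seq nat_of_bool (has (cheap_edge p g s) l) | s <- iota 0 nS] ++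
               [seq nat_of_bool (g < p r) | r <- iota 0 nR]]).
Proof.
apply: runs_seq; apply: runs_post (load_spec erefl) _.
move=> [m1 i1 o1] _ lm1 f1.
have z1 a : tag a > 5 -> tag a != 10 -> m1 a = (fun=> 0).
  by case: f1 => /(_ a) /= aE _ lt5 neq10; rewrite aE //; case: a lt5 neq10 {aE}.
have out1 : o1 = [::] by case: f1 => _ /(_ isT).
apply: runs_seq; apply: runs_post; first by apply: auction_spec => //; apply: z1.
move=> [m2 i2 o2] f2 mk _; have lm2 : loaded m2 by apply: loaded_frame f2 lm1.
have gap2 : m2 Gap 0 = 0 by case: f2 => /(_ Gap isT) /= -> _; rewrite z1.
apply: runs_seq; apply: runs_post (find_gap_spec lm2 gap2) _.
move=> [m3 i3 o3] f3 gp _; have lm3 : loaded m3 by apply: loaded_frame f3 lm2.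
have price3 : m3 Price = m2 Price by case: f3 => /(_ Price isT).
apply: runs_seq; apply: runs_post (print_S_spec lm3) _.
move=> [m4 i4 o4] f4 /= out4 _; have lm4 : loaded m4 by apply: loaded_frame f4 lm3.
have price4 : m4 Price = m2 Price by case: f4 => /(_ Price isT) /= ->.
have gap4 : m4 Gap 0 = m3 Gap 0 by case: f4 => /(_ Gap isT) /= ->.
apply: runs_post (print_R_spec lm4) _ => st _ outs.
exists (m2 Price), (m2 Owner), (m3 Gap 0); split=> //.
rewrite outs out4 price4 gap4 price3.
have -> // : o3 = [::].
by case: f3 => _ /(_ isT) /= ->; case: f2 => _ /(_ isT) /= ->.
Qed.

End Algorithm.

(** * Running time and conclusion *)

Lemma map_enum_rank (T : finType) (A : Type) (f : nat -> A) :
  [seq f (enum_rank x) | x <- enum T] = [seq f i | i <- iota 0 #|T|].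
Proof.
have -> : iota 0 #|T| = [seq nat_of_ord (enum_rank x) | x <- enum T].
  apply: (@eq_from_nth _ 0) => [|i]; first by rewrite size_iota size_map -cardE.
  rewrite size_iota => lti.
  rewrite nth_iota // add0n.
  have x0 : T by apply: (enum_val (Ordinal lti)).
  rewrite (nth_map x0) -?cardE //.
  by rewrite -[nth x0 _ i]/(nth x0 _ (Ordinal lti)) -(enum_val_nth x0) enum_valK.
by rewrite -map_comp.
Qed.

Lemma size_leq_bitlen w : size w <= bitlen w.
Proof. by rewrite /bitlen -sum1_size; apply: leq_sum. Qed.

(** |S| and |R| are given in binary, so only this keeps loops over the nodes
    polynomial in the length of the input. *)
Lemma card_sides (S R : finType) (E : {set S * R}) : no_isolated_node E ->
  #|S| <= #|E| /\ #|R| <= #|E|.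
Proof.
move=> iso; split.
  apply: leq_trans (leq_imset_card fst E); rewrite -cardsT.
  apply/subset_leq_card/subsetP => s _; have [[//|r] /= sr] := iso (inl s).
  by apply/imsetP; exists (s, r).
apply: leq_trans (leq_imset_card snd E); rewrite -cardsT.
apply/subset_leq_card/subsetP => r _; have [[s|//] /= sr] := iso (inr r).
by apply/imsetP; exists (s, r).
Qed.

Lemma halted_output P w T i X o T' : T <= T' ->
  reaches P T (start w) (Config (size P) X i o) -> outputs_within P w T' o.
Proof.
move=> leT [t let_ run]; rewrite /outputs_within.
have -> : iter T' (step P) (start w) = Config (size P) X i o; last by [].
rewrite -(subnK (leq_trans let_ leT)) iterD run.
by elim: (T' - t) => //= n ->; rewrite /step /= onth_default.
Qed.

Theorem theorem3 :
  exists (P : program) (c k : nat),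
    forall (S R : finType) (E : {set S * R}) (w : seq nat),
      no_isolated_node E ->
      encodes E w ->
      exists X : {set node S R},
        [/\ total_failure E X,
            forall Y : {set node S R}, total_failure E Y -> #|X| <= #|Y|
          & outputs_within P w (c * bitlen w ^ k + c) (node_set_code X)].
Proof.
have [a [k cost_le]] := cost_poly algorithm.
exists (compile algorithm 0), a, (2 * k) => S R E w iso [es es_E wE].
have [leSE leRE] := card_sides iso.
(* The program stores the edges in reverse order. *)
pose l := rev [seq (nat_of_ord (enum_rank e.1), nat_of_ord (enum_rank e.2)) | e <- es].
have sizel : size l = #|E| by rewrite size_rev size_map (perm_size es_E) -cardE.
have mem_l s r : ((nat_of_ord (enum_rank s), nat_of_ord (enum_rank r)) \in l) = ((s, r) \in E).
  rewrite mem_rev -[RHS]mem_enum -(perm_mem es_E).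
  apply/mapP/idP => [[[s' r'] e_es /= [/val_inj/enum_rank_inj-> /val_inj/enum_rank_inj->]] //|sr].
  by exists (s, r).
have l_mem i j : (i, j) \in l -> exists s r,
    [/\ i = enum_rank s, j = enum_rank r & (s, r) \in E].
  rewrite mem_rev => /mapP[[s r] e_es [-> ->]]; exists s, r; split=> //.
  by rewrite -mem_enum -(perm_mem es_E).
have l_lt i j : (i, j) \in l -> i < #|S| /\ j < #|R|.
  by move=> /l_mem[s [r [-> -> _]]]; rewrite !ltn_ord.
have {}wE : w = [:: #|S|; #|R|; size l] ++ pairs (rev l).
  by rewrite wE sizel /pairs revK -map_comp.
have lenw : 2 * #|E| + 3 <= bitlen w.
  apply: leq_trans (size_leq_bitlen w).
  have -> : size w = 3 + size (pairs (rev l)) by rewrite wE size_cat.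
  suff -> : size (pairs (rev l)) = 2 * size (rev l) by rewrite size_rev sizel addnC.
  by elim: (rev l) => //= e s IHs; rewrite /pairs /= -/(pairs s) IHs; lia.
(* The longest loop is that of the bids, with at most |R| (|R| + 2) + 1 rounds. *)
pose N := (#|E| + 2) ^ 2.
have NE : N = #|E| * #|E| + 4 * #|E| + 4 by rewrite /N -mulnn; lia.
have slack_lt : #|R| * (#|R| + 2) < N.
  have : #|R| * (#|R| + 2) <= #|E| * (#|E| + 2) by rewrite leq_mul ?leq_add2r.
  by rewrite NE; lia.
have hS : #|S| <= N by rewrite NE; lia.
have hR : #|R| < N by rewrite NE; lia.
have hE : size l <= N by rewrite sizel NE; lia.
have [X' [st [run _ _ [p [o [g [mk [g_range g_gap] outE]]]]]]] :=
  @algorithm_spec _ _ l l_lt N hS hR hE slack_lt (compile algorithm 0) 0 (fun=> 0)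
    (fun _ _ => erefl) (fun _ _ => erefl).
pose price (r : R) := p (enum_rank r).
pose owner (r : R) := [pick s : S | o (enum_rank r) == (enum_rank s).+1].
have ownerE r s : owner r = Some s -> o (enum_rank r) = (enum_rank s).+1.
  by rewrite /owner; case: pickP => // s' /eqP own [<-].
have owner_some r s : o (enum_rank r) = (enum_rank s).+1 -> owner r = Some s.
  move=> own; rewrite /owner; case: pickP => [s'|/(_ s)]; last by rewrite own eqxx.
  by rewrite own => /eqP[/val_inj/enum_rank_inj->].
have price_neq r : price r <> g by apply: g_gap.
exists (price_cover E price g); split.
- exact: price_cover_total_failure.
- apply: (@price_cover_min _ _ E price owner g).
  + move=> r high; case own: (o (enum_rank r)) => [|i].
      by move: high; rewrite /price (unsold mk (ltn_ord _) own).
    have [/l_mem[s [_ [si _ _]]] _] := content mk (ltn_ord _) own.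
    by rewrite (owner_some r s) // own si.
  + by move=> r s /ownerE own; have [+ _] := content mk (ltn_ord _) own; rewrite mem_l.
  + move=> r s r' /ownerE own sr'; have [_] := content mk (ltn_ord _) own.
    by apply; rewrite mem_l.
  + move=> r r' s /ownerE own /ownerE own'; apply/enum_rank_inj/val_inj.
    by apply: (owner_inj mk); rewrite ?own ?own' ?ltn_ord.
  + move=> s r sr cheap.
    have lts : 0 <= enum_rank s < #|S| by rewrite ltn_ord.
    have [[i lti own]|dear] := served mk lts isT.
      exists (enum_val (Ordinal lti)); apply: owner_some.
      by rewrite enum_valK.
    have := dear (enum_rank r); rewrite mem_l => /(_ sr).
    by move: cheap; rewrite /price; lia.
- have -> : node_set_code (price_cover E price g) = out st.
    rewrite outE /node_set_code -!map_enum_rank; congr (_ ++ _).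
      apply: eq_map => s; rewrite inE; congr nat_of_bool; apply/existsP/hasP.
        move=> [r /andP[sr cheap]]; exists (nat_of_ord (enum_rank s), nat_of_ord (enum_rank r)).
          by rewrite mem_l.
        by rewrite /cheap_edge eqxx.
      move=> [[i j] /l_mem[s' [r [-> -> sr]]] /andP[/eqP/val_inj/enum_rank_inj <- cheap]].
      by exists r; rewrite sr.
    by apply: eq_map => r; rewrite inE.
  have {}run : reaches (compile algorithm 0) (cost N algorithm) (start w)
      (Config (size (compile algorithm 0)) X' (inp st) (out st)).
    by rewrite wE; exact: run.
  apply: halted_output run.
  apply: leq_trans (cost_le N) _; apply: leq_trans (leq_addr _ _).
  have powle j x y : x <= y -> x ^ j <= y ^ j by case: j => // j; rewrite leq_exp2r.
  rewrite leq_mul2l expnM powle ?orbT // -mulnn.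
  by apply: leq_trans (leq_mul lenw lenw); rewrite NE; nia.
Qed.
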